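(* The complex structure on $\mathcal{Q}_\rho$ is compatible with the Hilbertian product in the following sense: for all $q\in\mathcal{Q}_\rho$ and $X,Y\in(T\mathcal{Q}_\rho)_q$, $$\langle\mathcal{I}_qX,Y\rangle_q=-\langle X,\mathcal{I}_qY\rangle_q.$$
   Context: $\mathcal{A}$ is a unital C$^*$-algebra with unitary group $\mathcal{U}_{\mathcal{A}}$; $M_2(\mathcal{A})$ acts on the right $\mathcal{A}$-module $\mathcal{A}^2$ of column vectors $\mathbf{x}=(x_1,x_2)^t$, and $\mathbf{x}^*=(x_1^*,x_2^* )$. Let $\rho=\begin{pmatrix}1&0\\0&-1\end{pmatrix}$ and $\theta(\mathbf{x},\mathbf{y})=\mathbf{x}^*\rho\mathbf{y}=x_1^*y_1-x_2^*y_2$. For $\tilde a\in M_2(\mathcal{A})$ put $\tilde a^\sharp=\rho\tilde a^*\rho$. $\mathcal{Q}_\rho$ is the set of idempotents $q\in M_2(\mathcal{A})$ with $q^\sharp=q$ such that $\theta(\mathbf{x},\mathbf{x})\ge0$ on the range $R(q)$ and $\theta(\mathbf{x},\mathbf{x})\le 0$ on the nullspace $N(q)$. It is a complemented $C^\infty$ submanifold of $M_2(\mathcal{A})$ with $(T\mathcal{Q}_\rho)_q=\{X\in M_2(\mathcal{A}):\rho X^*\rho=X,\ Xq+qX=X\}$. Let $\mathcal{K}=\{\mathbf{x}\in\mathcal{A}^2:\theta(\mathbf{x},\mathbf{x})=1,\ x_1\text{ invertible}\}$ and, for $\mathbf{x}\in\mathcal{K}$, $p_{\mathbf{x}}=\mathbf{x}\mathbf{x}^*\rho\in\mathcal{Q}_\rho$;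 every $q\in\mathcal{Q}_\rho$ is $p_{\mathbf{x}}$ for some $\mathbf{x}\in\mathcal{K}$, unique up to $\mathbf{x}\mapsto\mathbf{x}u$, $u\in\mathcal{U}_{\mathcal{A}}$, and $\{\mathbf{x}\}$ is a basis of the right $\mathcal{A}$-module $R(q)$. $\mathcal{C}_q=\mathcal{L}_{\mathcal{A}}(R(q))$ is the space of right $\mathcal{A}$-module endomorphisms of $R(q)$; for $p_{\mathbf{x}}=q$ and $a\in\mathcal{A}$, $[(\mathbf{x},a)]\in\mathcal{C}_q$ is the endomorphism $\mathbf{x}b\mapsto\mathbf{x}ab$, so $[(\mathbf{x},a)]=[(\mathbf{x}u,u^*au)]$ for $u\in\mathcal{U}_{\mathcal{A}}$. Hilbertian product: $\langle X,Y\rangle_q=[(\mathbf{x},-\theta(X\mathbf{x},Y\mathbf{x}))]\in\mathcal{C}_q$ for $X,Y\in(T\mathcal{Q}_\rho)_q$ and $p_{\mathbf{x}}=q$ (independent of $\mathbf{x}$). Complex structure: $\mathcal{I}_q:(T\mathcal{Q}_\rho)_q\to(T\mathcal{Q}_\rho)_q$, $\mathcal{I}_qX=i\,X(2q-1)$; it satisfies $\mathcal{I}_q^2=-1$. *)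

(* Defs.v *)
From HB Require Import structures.
From mathcomp Require Import all_boot all_order all_algebra.
From mathcomp Require Import complex.
From mathcomp Require Import boolp classical_sets reals.

Set Implicit Arguments.
Unset Strict Implicit.
Unset Printing Implicit Defensive.

Import Order.TTheory GRing.Theory Num.Theory.

Local Open Scope classical_set_scope.
Local Open Scope complex_scope.
Local Open Scope ring_scope.

(* Unital (nonzero) C*-algebras over R[i]. The norm is a field of the mixin
   rather than a [normedModType] structure: Hierarchy Builder rejects a join of
   rings and normed modules, because Num.NumDomain already is one. The norm is
   nonnegative by cstar_normD and cstar_normZ. *)
HB.mixin Record isCStarAlgebra (R : realType) A of GRing.Algebra R[i] A := {
  star : A -> A;
  starK : involutive star;
  starD : {morph star : a b / a + b};
  starZ : forall (c : R[i]) (a : A), star (c *: a) = c^* *: star a;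
  starM : forall a b : A, star (a * b) = star b * star a;
  cstar_norm : A -> R;
  cstar_norm0_eq0 : forall a : A, cstar_norm a = 0 -> a = 0;
  cstar_normD : forall a b : A,
    cstar_norm (a + b) <= cstar_norm a + cstar_norm b;
  cstar_normZ : forall (c : R[i]) (a : A),
    cstar_norm (c *: a) = complex.Re `|c| * cstar_norm a;
  cstar_normM : forall a b : A,
    cstar_norm (a * b) <= cstar_norm a * cstar_norm b;
  cstar_normE : forall a : A, cstar_norm (star a * a) = cstar_norm a ^+ 2;
  cstar_complete : forall u : nat -> A,
    (forall e : R, 0 < e -> exists N, forall m n,
       (N <= m)%N -> (N <= n)%N -> cstar_norm (u m - u n) < e) ->
    exists l : A, forall e : R, 0 < e -> exists N, forall n,
      (N <= n)%N -> cstar_norm (u n - l) < e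
}.

#[short(type="cstarAlgType")]
HB.structure Definition CStarAlgebra (R : realType) :=
  {A of GRing.Algebra R[i] A & isCStarAlgebra R A}.

Section Positive.
Context {R : realType} {A : cstarAlgType R}.
Implicit Types a b : A.

Definition invertible a := exists2 b, a * b = 1 & b * a = 1.

Definition spectrum a : set R[i] := [set l | ~ invertible (a - l%:A)].

(* The order of R[i] is such that 0 <= l iff l is a nonnegative real. *)
Definition cstar_ge0 a := star a = a /\ spectrum a `<=` [set l | 0 <= l].

Definition unitary (u : A) := u * star u = 1 /\ star u * u = 1.

End Positive.

Section Matrices.
Context {R : realType} {A : cstarAlgType R}.

Definition adjmx m n (M : 'M[A]_(m, n)) : 'M[A]_(n, m) := (map_mx star M)^T.

Definition rho : 'M[A]_2 := diag_mx (\row_(j < 2) (-1) ^+ j).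

Definition theta (x y : 'cV[A]_2) : A := (adjmx x *m rho *m y) 0 0.

Lemma star0 : star 0 = 0 :> A.
Proof. by rewrite -(scale0r 0) starZ rmorph0 !scale0r. Qed.

Lemma starB : {morph (star : A -> A) : a b / a - b}.
Proof.
move=> a b; rewrite starD; congr (_ + _); apply/eqP.
by rewrite -addr_eq0 -starD addNr star0.
Qed.

Lemma thetaE (x y : 'cV[A]_2) :
  theta x y = star (x 0 0) * y 0 0 - star (x 1 0) * y 1 0.
Proof.
rewrite /theta mul_mx_diag !mxE !big_ord_recl big_ord0 !mxE addr0.
have -> : lift ord0 ord0 = 1 :> 'I_2 by apply/val_inj.
rewrite expr0 mulr1 expr1 mulrN1 mulNr.
by have -> : ord0 = 0 :> 'I_2 by apply/val_inj.
Qed.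

Definition sharp (M : 'M[A]_2) : 'M[A]_2 := rho *m adjmx M *m rho.

Definition Qrho : set 'M[A]_2 := [set q |
  [/\ q *m q = q, sharp q = q,
      forall x, (exists w, x = q *m w) -> cstar_ge0 (theta x x) &
      forall x, q *m x = 0 -> cstar_ge0 (- theta x x)]].

Definition tangent (q : 'M[A]_2) : set 'M[A]_2 :=
  [set X | rho *m adjmx X *m rho = X /\ X *m q + q *m X = X].

Definition complex_structure (q X : 'M[A]_2) : 'M[A]_2 :=
  map_mx (fun a => 'i%C *: a) (X *m (q *+ 2 - 1%:M)).

Definition Kset : set 'cV[A]_2 :=
  [set x | theta x x = 1 /\ invertible (x 0 0)].

Definition proj_of (x : 'cV[A]_2) : 'M[A]_2 := x *m adjmx x *m rho.

(* The range R(q) as a right A-module, that is, a left module over the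
   converse ring A^c: for b : A^c, b *: x is the column of the x_i * b. *)
Definition in_range (q : 'M[A]_2) : {pred 'cV[A^c]_2} :=
  fun x => `[< exists w : 'cV[A]_2, x = q *m w >].

Lemma rscaleE (b : A^c) (x : 'cV[A^c]_2) i :
  (b *: x) i 0 = (x i 0 : A) * (b : A) :> A.
Proof. by rewrite mxE. Qed.

Fact in_range_submod q : submod_closed (in_range q).
Proof.
split; first by apply/asboolP; exists 0; rewrite mulmx0.
move=> b x y /asboolP[v ->] /asboolP[w ->]; apply/asboolP.
exists ((b : A^c) *: (v : 'cV[A^c]_2) + w); rewrite mulmxDr; congr (_ + _).
apply/matrixP => i j; rewrite ord1 rscaleE !mxE /= big_distrl /=.
by apply: eq_bigr => k _; rewrite rscaleE mulrA.
Qed.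

HB.instance Definition _ q :=
  GRing.isSubmodClosed.Build A^c 'cV[A^c]_2 (in_range q) (in_range_submod q).

Record rangeM (q : 'M[A]_2) := RangeM {
  range_val :> 'cV[A^c]_2;
  range_valP : range_val \in in_range q
}.
HB.instance Definition _ q := [isSub for @range_val q].
HB.instance Definition _ q := [Choice of rangeM q by <:].
HB.instance Definition _ q := [SubChoice_isSubLmodule of rangeM q by <:].

End Matrices.

Section Endomorphisms.
Context {R : realType} {A : cstarAlgType R}.
Implicit Types (q X Y : 'M[A]_2) (x y z : 'cV[A]_2) (a b u : A).

(* C_q, the right A-module endomorphisms of R(q). *)
Definition endR q := {linear rangeM q -> rangeM q}.

Lemma endR_ext q (S T : endR q) : S =1 T -> S = T.
Proof.
case: S T => [s [[s1] [s2]]] [t [[t1] [t2]]] /= /funext est.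
by subst t; congr (GRing.Linear.Pack (GRing.Linear.Class _ _));
  congr (_ _); apply: Prop_irrelevance.
Qed.

HB.instance Definition _ q := gen_eqMixin (endR q).
HB.instance Definition _ q := gen_choiceMixin (endR q).

Definition endR0 q : endR q := \0.
Definition endR_opp q (S : endR q) : endR q := \- S.
Definition endR_add q (S T : endR q) : endR q := S \+ T.

Fact endR_addA q : associative (@endR_add q).
Proof. by move=> S T U; apply: endR_ext => v /=; rewrite addrA. Qed.
Fact endR_addC q : commutative (@endR_add q).
Proof. by move=> S T; apply: endR_ext => v /=; rewrite addrC. Qed.
Fact endR_add0 q : left_id (endR0 q) (@endR_add q).
Proof. by move=> S; apply: endR_ext => v /=; rewrite add0r. Qed.
Fact endR_addN q : left_inverse (endR0 q) (@endR_opp q) (@endR_add q).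
Proof. by move=> S; apply: endR_ext => v /=; rewrite addNr. Qed.

HB.instance Definition _ q := GRing.isZmodule.Build (endR q)
  (@endR_addA q) (@endR_addC q) (@endR_add0 q) (@endR_addN q).

(* The bases x in K of R(q) such that p_x = q. *)
Record frame q := Frame {
  frame_val :> 'cV[A]_2;
  frameK : Kset frame_val;
  frame_proj : proj_of frame_val = q
}.

Lemma theta_rscale x y (b : A^c) :
  theta x (b *: (y : 'cV[A^c]_2)) = theta x y * (b : A).
Proof.
rewrite /theta !mxE big_distrl /=; apply: eq_bigr => k _.
by rewrite rscaleE mulrA.
Qed.

Lemma thetaD x y z : theta x (y + z) = theta x y + theta x z.
Proof. by rewrite /theta mulmxDr mxE. Qed.

Lemma proj_of_mul x y : proj_of x *m y = (theta x y : A^c) *: (x : 'cV[A^c]_2).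
Proof.
apply/matrixP => i j; rewrite ord1 rscaleE /proj_of -!mulmxA mxE.
by rewrite big_ord1 /theta -mulmxA.
Qed.

Lemma frame_mul q (x : frame q) z :
  q *m z = (theta x z : A^c) *: (frame_val x : 'cV[A^c]_2).
Proof. by rewrite -proj_of_mul frame_proj. Qed.

Lemma frame_in_range q (x : frame q) : (x : 'cV[A^c]_2) \in in_range q.
Proof.
apply/asboolP; exists (frame_val x).
by rewrite (frame_mul x) (frameK x).1 scale1r.
Qed.

Definition frame_gen q (x : frame q) : rangeM q := RangeM (frame_in_range x).

Lemma frame_coord q (x : frame q) (z : rangeM q) :
  z = (theta x (range_val z) : A^c) *: frame_gen x.
Proof.
apply/val_inj => /=; have /asboolP[w ->] := range_valP z.
by rewrite (frame_mul x) theta_rscale (frameK x).1 mul1r.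
Qed.

Fact bracket_linear q (x : frame q) a : linear (fun z : rangeM q =>
  ((a * theta x (range_val z) : A) : A^c) *: frame_gen x).
Proof.
move=> b z w; have -> : theta x (range_val (b *: z + w)) =
    theta x (range_val z) * (b : A) + theta x (range_val w).
  by rewrite -theta_rscale -thetaD.
by rewrite mulrDr mulrA scalerDl scalerA.
Qed.

(* The endomorphism [(x, a)], which maps x b to x a b by [bracketE]; theta x z
   is the coordinate of z in the basis x. *)
Definition bracket q (x : frame q) a : endR q :=
  HB.pack_for (endR q) (fun z : rangeM q =>
    ((a * theta x (range_val z) : A) : A^c) *: frame_gen x)
   (GRing.isLinear.Build _ _ _ _ _ (bracket_linear x a)).

Lemma bracketE q (x : frame q) a b :
  bracket x a ((b : A^c) *: frame_gen x) = (a * b : A^c) *: frame_gen x.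
Proof.
have th : theta x (range_val ((b : A^c) *: frame_gen x)) = b.
  transitivity (theta x ((b : A^c) *: (x : 'cV[A^c]_2))); first by [].
  by rewrite theta_rscale (frameK x).1 mul1r.
by rewrite /= th.
Qed.

Lemma theta_star x y : star (theta x y) = theta y x.
Proof. by rewrite !thetaE starB !starM !starK. Qed.

Lemma theta_frame q (x y : frame q) z : theta x y * theta y z = theta x z.
Proof.
rewrite -(theta_rscale x y) -(frame_mul y) (frame_mul x).
by rewrite theta_rscale (frameK x).1 mul1r.
Qed.

Lemma frame_unitary q (x y : frame q) :
  unitary (theta x y) /\
  frame_gen y = (theta x y : A^c) *: frame_gen x.
Proof.
split; last exact: frame_coord.
by rewrite /unitary theta_star !theta_frame (frameK x).1 (frameK y).1.
Qed.

(* The value does not depend on the basis, by [hermE]. The default value 0 of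
   [xget] is taken only if q is not of the form p_x with x in K, which never
   happens for q in Q_rho. *)
Definition herm q X Y : endR q :=
  xget 0 [set T | exists x : frame q,
    T = bracket x (- theta (X *m frame_val x) (Y *m frame_val x))].

Lemma bracket_unitary q (x y : frame q) a :
  bracket y (theta y x * a * theta x y) = bracket x a.
Proof.
apply: endR_ext => z /=; have [_ ->] := frame_unitary x y.
rewrite scalerA; congr (_ *: _).
transitivity (theta x y * (theta y x * a * theta x y * theta y (range_val z))).
  by [].
by rewrite !mulrA theta_frame (frameK x).1 mul1r -mulrA theta_frame.
Qed.

Lemma mulmx_rscale (M : 'M[A]_2) (b : A^c) y :
  M *m (b *: (y : 'cV[A^c]_2)) = b *: (M *m y : 'cV[A^c]_2).
Proof.
apply/matrixP => i j; rewrite ord1 rscaleE !mxE big_distrl /=.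
by apply: eq_bigr => k _; rewrite rscaleE mulrA.
Qed.

Lemma frame_rscale q (x y : frame q) :
  frame_val y = (theta x y : A^c) *: (frame_val x : 'cV[A^c]_2).
Proof.
by rewrite -(frame_mul x) (frame_mul y) (frameK y).1 scale1r.
Qed.

Lemma hermE q (x : frame q) X Y :
  herm q X Y = bracket x (- theta (X *m frame_val x) (Y *m frame_val x)).
Proof.
rewrite /herm; case: xgetP => [T _ [y ->]|no]; last first.
  by case: (no (bracket x (- theta (X *m frame_val x) (Y *m frame_val x))));
    exists x.
rewrite -(bracket_unitary x y); congr bracket.
have fy M : M *m frame_val y =
    (theta x y : A^c) *: (M *m frame_val x : 'cV[A^c]_2).
  by rewrite {1}(frame_rscale x y) mulmx_rscale.
rewrite !fy theta_rscale -[theta ((_ : A^c) *: _) _]theta_star theta_rscale.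
rewrite starM !theta_star.
by rewrite mulrN mulNr.
Qed.

Let iscale m n (M : 'M[A]_(m, n)) := map_mx (fun a : A => 'i%C *: a) M.

Let iscaleMl (M N : 'M[A]_2) : iscale (M *m N) = iscale M *m N.
Proof.
apply/matrixP => i j; rewrite !mxE scaler_sumr; apply: eq_bigr => k _.
by rewrite mxE scalerAl.
Qed.

Let iscaleMr (M N : 'M[A]_2) : iscale (M *m N) = M *m iscale N.
Proof.
apply/matrixP => i j; rewrite !mxE scaler_sumr; apply: eq_bigr => k _.
by rewrite mxE scalerAr.
Qed.

Let iscaleD (M N : 'M[A]_2) : iscale (M + N) = iscale M + iscale N.
Proof. by apply/matrixP => i j; rewrite !mxE scalerDr. Qed.

Let iscaleN (M : 'M[A]_2) : iscale (- M) = - iscale M.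
Proof. by apply/matrixP => i j; rewrite !mxE scalerN. Qed.

Let adj_iscale (M : 'M[A]_2) : adjmx (iscale M) = - iscale (adjmx M).
Proof.
apply/matrixP => i j; rewrite !mxE starZ -scaleNr; congr (_ *: _).
by apply/eqP; rewrite eq_complex /= oppr0 !eqxx.
Qed.

Let starS (I : Type) (r : seq I) (F : I -> A) :
  star (\sum_(i <- r) F i) = \sum_(i <- r) star (F i).
Proof.
exact: (big_morph _ starD star0).
Qed.

Lemma adjmxM (M N : 'M[A]_2) : adjmx (M *m N) = adjmx N *m adjmx M.
Proof.
apply/matrixP => i j; rewrite !mxE starS; apply: eq_bigr => k _.
by rewrite starM !mxE.
Qed.

Lemma adjmxB (M N : 'M[A]_2) : adjmx (M - N) = adjmx M - adjmx N.
Proof. by apply/matrixP => i j; rewrite !mxE starB. Qed.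

Lemma star1 : star 1 = 1 :> A.
Proof. by rewrite -[RHS]starK -[in RHS](mulr1 (star 1)) starM starK mulr1. Qed.

Lemma adjmx1 : adjmx (1%:M : 'M[A]_2) = 1%:M.
Proof.
apply/matrixP => i j; rewrite !mxE [j == i]eq_sym.
by case: (i == j); rewrite ?star1 ?star0.
Qed.

Lemma rho_sqr : rho *m rho = 1%:M :> 'M[A]_2.
Proof.
apply/matrixP => i j; rewrite /rho mul_diag_mx !mxE mulrnAr.
by rewrite -exprD addnn -mul2n exprM sqrrN expr1n expr1n.
Qed.

Lemma sharpM (M N : 'M[A]_2) : sharp (M *m N) = sharp N *m sharp M.
Proof.
rewrite /sharp adjmxM !mulmxA; congr (_ *m _).
by rewrite -!mulmxA; congr (_ *m (_ *m _)); rewrite mulmxA rho_sqr mul1mx.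
Qed.

Lemma tangent_complex_structure q X :
  Qrho q -> tangent q X -> tangent q (complex_structure q X).
Proof.
move=> [qq qs _ _] [Xs XT].
have qXq : q *m X *m q = 0.
  have := congr1 (mulmx q) XT; rewrite mulmxDr !mulmxA qq.
  by move/(canRL (addrK _)); rewrite subrr.
have XS : X *m (q *+ 2 - 1%:M) = X *m q - q *m X.
  by rewrite mulmxBr mulmx1 mulr2n mulmxDr -[X in _ - X]XT opprD addrACA subrr
    add0r.
have JE : complex_structure q X = iscale (X *m q - q *m X).
  by rewrite -XS.
rewrite JE; split.
  rewrite adj_iscale mulmxN mulNmx -iscaleMr -iscaleMl -iscaleN.
  congr iscale; rewrite adjmxB mulmxBr mulmxBl -!/(sharp _) !sharpM qs.
  by rewrite [sharp X]Xs opprB.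
rewrite -iscaleMl -iscaleMr -iscaleD; congr iscale.
rewrite mulmxBl mulmxBr !mulmxA qXq subr0 sub0r qq -[X *m q *m q]mulmxA qq.
by [].
Qed.

End Endomorphisms.

(* Main.v *)
Require Import Defs.
From mathcomp Require Import all_boot all_order all_algebra.
From mathcomp Require Import complex.
From mathcomp Require Import boolp classical_sets reals.

(** On the range of [q] the symmetry [2q - 1] is the identity, so a basis [x]
    of [R(q)] satisfies [(I_q X) x = i (X x)] ([complex_structure_frame]).
    Since [theta] is conjugate linear in its first argument and linear in its
    second one, [theta(i X x, Y x) = - i theta(X x, Y x)] whereas
    [theta(X x, i Y x) = i theta(X x, Y x)]. The two values are opposite, and
    [bracket x] is additive, which gives the identity in [C_q].

    The product [herm] is given by a choice among its values in the bases
    [x] with [p_x = q]: [hermE] computes it from any such basis, and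
    [herm_noframe] settles the degenerate value. *)

Import GRing.Theory.
Local Open Scope ring_scope.

Section Compatibility.
Context {R : realType} {A : cstarAlgType R}.
Implicit Types (q X Y : 'M[A]_2) (v w : 'cV[A]_2) (c : R[i]).

Lemma theta_scaler v w c :
  theta v (map_mx (fun a : A => c *: a) w) = c *: theta v w.
Proof. by rewrite !thetaE !mxE -!scalerAr scalerBr. Qed.

Lemma theta_scalel v w c :
  theta (map_mx (fun a : A => c *: a) v) w = (c^*)%C *: theta v w.
Proof. by rewrite !thetaE !mxE !starZ -!scalerAl scalerBr. Qed.

Lemma frame_fixed q (x : frame q) : q *m frame_val x = frame_val x.
Proof. by rewrite (frame_mul x) (frameK x).1 scale1r. Qed.

(** The factor [2q - 1] disappears when [x] spans the range of [q]; what is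
    left of the complex structure is the scalar [i]. *)
Lemma complex_structure_frame q X (x : frame q) :
  complex_structure q X *m frame_val x =
  map_mx (fun a : A => 'i%C *: a) (X *m frame_val x).
Proof.
have -> : X *m frame_val x = X *m (q *+ 2 - 1%:M) *m frame_val x.
  by rewrite -mulmxA mulmxBl mul1mx mulr2n mulmxDl frame_fixed addrK.
apply/matrixP => i j; rewrite !mxE scaler_sumr; apply: eq_bigr => k _.
by rewrite mxE scalerAl.
Qed.

Lemma bracketN q (x : frame q) a : bracket x (- a) = - bracket x a.
Proof. by apply: endR_ext => z /=; rewrite mulNr scaleNr. Qed.

Lemma herm_noframe q X Y : ~ inhabited (frame q) -> herm q X Y = 0.
Proof.
move=> nof; rewrite /herm; case: xgetP => [T _ [x _]|//].
by case: nof; exists.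
Qed.

End Compatibility.

Theorem theorem5p3 (R : realType) (A : cstarAlgType R) (q X Y : 'M[A]_2)
    (hq : Qrho q) (hX : tangent q X) (hY : tangent q Y) :
  herm q (complex_structure q X) Y = - herm q X (complex_structure q Y).
Proof.
have [[x]|nof] := pselect (inhabited (frame q)); last first.
  by rewrite !herm_noframe // oppr0.
rewrite !(hermE x) !complex_structure_frame theta_scalel theta_scaler.
rewrite -bracketN opprK -scaleNr; congr (bracket x (_ *: _)).
(* Both coefficients are [i]: on the left as the opposite of its conjugate. *)
by apply/eqP; rewrite eq_complex /= oppr0 opprK !eqxx.
Qed.
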